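(* Let $c:\mathbb{R}^d\times\mathbb{R}^d\to[0,\infty]$ be Borel measurable, symmetric, and lower semicontinuous, and let $\mu\in\mathcal{P}(\mathbb{R}^d)$. Then there exists $\gamma^{opt}\in\mathcal{P}^\infty_{sym}(\mathbb{R}^d)$ with $\gamma^{opt}\mapsto\mu$ and $C_\infty[\gamma^{opt}]=F^{OT}_\infty[\mu]$, and there exists an infinitely representable $\mu_2^{opt}\in\mathcal{P}_{sym}(\mathbb{R}^{2d})$ with $\mu_2^{opt}\mapsto\mu$ attaining the infimum $\inf\{\int c\,d\mu_2:\mu_2\in\mathcal{P}_{sym}(\mathbb{R}^{2d}),\ \mu_2\mapsto\mu,\ \mu_2\text{ infinitely representable}\}$.
   Context: $\mathcal{P}^\infty_{sym}(\mathbb{R}^d)$: Borel probability measures on the product $(\mathbb{R}^d)^\infty$ all of whose finite-dimensional marginals are invariant under permutations of the coordinates involved; $\gamma\mapsto\mu$ means the one-body marginal is $\mu$. $\mathcal{P}_{sym}(\mathbb{R}^{2d})$: Borel probability measures on $\mathbb{R}^d\times\mathbb{R}^d$ invariant under swapping the factors. $\mu_2$ is infinitely representable if some $\gamma\in\mathcal{P}^\infty_{sym}(\mathbb{R}^d)$ has two-body marginal (on any pair of coordinates) equal to $\mu_2$. $C_\infty[\gamma]:=\lim_{N\to\infty}\binom{N}{2}^{-1}\int\sum_{1\le i<j\le N}c(x_i,x_j)\,d\gamma$, $F^{OT}_\infty[\mu]:=\inf\{C_\infty[\gamma]:\gamma\in\mathcal{P}^\infty_{sym}(\mathbb{R}^d),\gamma\mapsto\mu\}$.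 *)

(* Defs.v *)
From HB Require Import structures.
From mathcomp Require Import all_boot all_order all_algebra fingroup perm.
From mathcomp Require Import all_classical all_reals ereal topology normedtype sequences measure lebesgue_measure measurable_realfun lebesgue_integral probability.
Unset Printing Implicit Defensive.
Import Order.TTheory GRing.Theory Num.Theory.
Import numFieldNormedType.Exports.
Local Open Scope classical_set_scope.
Local Open Scope ring_scope.

Definition Rd (R : realType) (d : nat) :=
  g_sigma_algebraType (@open 'rV[R]_d).

(* (R^d)^infty = sequences of points of R^d, with the product sigma-algebra
   (generated by the preimages of open sets under coordinate maps). *)
Definition cylinders (R : realType) (d : nat) : set (set (nat -> 'rV[R]_d)) :=
  \bigcup_(i in [set: nat])
     preimage_set_system setT (fun x : nat -> 'rV[R]_d => x i) (@open 'rV[R]_d).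

Definition Rinf (R : realType) (d : nat) := g_sigma_algebraType (cylinders R d).

Definition cost2 {R : realType} {d : nat} (c : 'rV[R]_d * 'rV[R]_d -> \bar R)
  : Rd R d * Rd R d -> \bar R := c.

Definition coords {R : realType} {d n : nat} (f : 'I_n -> nat) (x : Rinf R d)
  : n.-tuple (Rd R d) := [tuple (x (f i) : Rd R d) | i < n].

Definition sym_inf {R : realType} {d : nat} (gam : probability (Rinf R d) R) :=
  forall (n : nat) (f : 'I_n -> nat), injective f ->
  forall (s : {perm 'I_n}) (B : set (n.-tuple (Rd R d))), measurable B ->
    gam (coords f @^-1` B) = gam (coords (f \o s) @^-1` B).

Definition one_body {R : realType} {d : nat} (gam : probability (Rinf R d) R)
  (mu : probability (Rd R d) R) :=
  forall A : set (Rd R d), measurable A -> gam [set x | A (x 0%N)] = mu A.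

Definition two_body {R : realType} {d : nat} (gam : probability (Rinf R d) R)
  (mu2 : probability (Rd R d * Rd R d)%type R) :=
  forall i j : nat, i <> j -> forall A : set (Rd R d * Rd R d)%type, measurable A ->
    gam [set x | A (x i, x j)] = mu2 A.

Definition sym2 {R : realType} {d : nat} (mu2 : probability (Rd R d * Rd R d)%type R) :=
  forall A : set (Rd R d * Rd R d)%type, measurable A ->
    mu2 [set p | A (p.2, p.1)] = mu2 A.

Definition one_body2 {R : realType} {d : nat}
  (mu2 : probability (Rd R d * Rd R d)%type R) (mu : probability (Rd R d) R) :=
  forall A : set (Rd R d), measurable A -> mu2 [set p | A p.1] = mu A.

Definition inf_representable {R : realType} {d : nat}
  (mu2 : probability (Rd R d * Rd R d)%type R) :=
  exists gam : probability (Rinf R d) R, sym_inf gam /\ two_body gam mu2.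

Local Open Scope ereal_scope.

Definition C_inf {R : realType} {d : nat} (c : 'rV[R]_d * 'rV[R]_d -> \bar R)
  (gam : probability (Rinf R d) R) : \bar R :=
  limn (fun N : nat =>
    (('C(N, 2))%:R^-1)%:E *
      \int[gam]_(x in [set: Rinf R d])
         (\sum_(i < N) \sum_(j < N | (i < j)%N) c (x i, x j))).

Definition F_OT {R : realType} {d : nat} (c : 'rV[R]_d * 'rV[R]_d -> \bar R)
  (mu : probability (Rd R d) R) : \bar R :=
  ereal_inf [set C_inf c gam | gam in
              [set gam : probability (Rinf R d) R | sym_inf gam /\ one_body gam mu]].

(* Main.v *)
(** Along a minimizing sequence of exchangeable laws, take setwise limits along
    a free ultrafilter. The limit [L] is a finitely additive probability on
    [Rinf], exchangeable, whose one-body marginals are exactly [mu]. Since [mu]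
    is tight, [L] is sigma-additive on the algebra of sets that it approximates
    from inside by closed and from outside by open sets (the argument of
    Marczewski and Ryll-Nardzewski); this algebra contains the open cylinders,
    so Caratheodory's theorem turns [L] into a countably additive law [gam].
    Open sets of pairs are countable unions of open boxes, hence [gam] gives
    the superlevel sets of the lower semicontinuous cost at most the mass that
    [L] gives them, and summing over levels shows that [gam] is optimal. By
    exchangeability [C_inf c gam] is the integral of [c] against the two-body
    marginal, so both minimization problems have the same solution. The
    competitor set is nonempty because of the law of [(X, X, X, ...)]. *)

Require Import Defs.
From HB Require Import structures.
From mathcomp Require Import all_boot all_order all_algebra fingroup perm.
From mathcomp Require Import all_classical all_reals ereal topology normedtype sequences numfun measure lebesgue_measure measurable_realfun lebesgue_integral probability.
Import Order.TTheory GRing.Theory Num.Theory.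
Import numFieldNormedType.Exports.
Local Open Scope classical_set_scope.
Local Open Scope ring_scope.
Local Open Scope ereal_scope.

Set Implicit Arguments.
Unset Strict Implicit.

(** * Limits along ultrafilters *)

(** Compactness gives a cluster point of the image of [U]; since [U] contains each set or its
    complement, a cluster point is a limit. *)
Lemma ultra_compact_cvg (I : Type) (T : topologicalType) (U : set_system I)
    (C : set T) (u : I -> T) :
  UltraFilter U -> compact C -> U (u @^-1` C) ->
  exists2 p, C p & u i @[i --> U] --> p.
Proof.
move=> UU cC UC.
have [p [Cp pcl]] := cC (u @ U) _ UC.
exists p => // V pV; have [//|UnV] := in_ultra_setVsetC (u @^-1` V) UU.
by have [x [nVx /nVx]] := pcl (~` V) V UnV pV.
Qed.

(* Along an ultrafilter every bounded sequence converges, so the setwise limit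
   of probabilities exists; in general it is only finitely additive. *)
Lemma ultralimit_content (I : Type) (dd : measure_display)
    (T : measurableType dd) (R : realType) (U : set_system I)
    (P : I -> probability T R) :
  UltraFilter U -> exists L : {content set T -> \bar R},
    forall A, measurable A -> P i A @[i --> U] --> L A.
Proof.
move=> UU.
have cvgP (A : set T) : exists l : \bar R, 0 <= l /\
    (measurable A -> P i A @[i --> U] --> l).
  (* Nonmeasurable sets get the default value 0, because a content has to be nonnegative on every
     set. *)
  have [mA|nmA] := pselect (measurable A); last by exists 0.
  have : U ((fun i => fine (P i A)) @^-1` `[0%R, 1%R]%classic).
    apply: filterS filterT => i _ /=; rewrite in_itv /= fine_ge0 //=.
    by rewrite -lee_fin fineK ?fin_num_measure// probability_le1.
  move=> /(ultra_compact_cvg UU (@segment_compact R 0 1))[l].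
  rewrite /= in_itv /= => /andP[l0 _] Pl; exists l%:E; split=> [|_].
    by rewrite lee_fin.
  rewrite (_ : (fun i => P i A) = (fun i => (fine (P i A))%:E)).
    by apply/fine_cvgP; split; [apply: filterS filterT|].
  by apply/funext => i; rewrite fineK ?fin_num_measure.
have [L LP] := choice cvgP.
have L0 (A : set T) : 0 <= L A by case: (LP A).
have Lcvg (A : set T) : measurable A -> P i A @[i --> U] --> L A.
  by case: (LP A).
have Lset0 : L set0 = 0.
  have := Lcvg _ measurable0.
  under eq_fun do rewrite measure0.
  by move=> /(cvg_unique _); apply => //; exact: cvg_cst.
have Ladd : measure_function.semi_additive L.
  apply/(additive2P Lset0) => A B mA mB AB0.
  have := Lcvg _ (measurableU _ _ mA mB).
  under eq_fun do rewrite measureU//.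
  move=> /(cvg_unique _); apply => //.
  apply: cvgeD; [|exact: Lcvg|exact: Lcvg].
  by rewrite ge0_adde_def// inE L0.
pose Lc : {content set T -> \bar R} :=
  HB.pack L (isContent.Build _ _ _ L L0 Ladd).
by exists Lc.
Qed.

Lemma content_leU2 (dd : measure_display) (T : ringOfSetsType dd)
    (R : realType) (m : {content set T -> \bar R}) (C A B : set T) :
  measurable C -> measurable A -> measurable B -> C `<=` A `|` B ->
  m C <= m A + m B.
Proof.
move=> mC mA mB CAB.
have := @content_subadditive _ _ _ m C (bigcup2 A B) 2%N.
rewrite !big_ord_recl !big_ord0 setU0 addr0 /=; apply => //.
by move=> [|[|]].
Qed.

(* Closedness in the product topology, phrased through coordinatewise limits
   along ultrafilters. *)
Definition seq_closed {V : topologicalType} (F : set (nat -> V)) :=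
  forall (U : set_system nat) (p : nat -> nat -> V) (q : nat -> V),
    UltraFilter U -> (forall i, p k i @[k --> U] --> q i) ->
    U [set k | F (p k)] -> F q.

(** * Closed sets of sequences *)

Section seq_closed_theory.
Context {V : topologicalType}.
Implicit Types F G : set (nat -> V).

Lemma seq_closed0 : seq_closed (set0 : set (nat -> V)).
Proof. by move=> U p q UU _ /filter_ex[]. Qed.

Lemma seq_closedT : seq_closed (setT : set (nat -> V)).
Proof. by []. Qed.

Lemma seq_closedI F G : seq_closed F -> seq_closed G -> seq_closed (F `&` G).
Proof.
move=> cF cG U p q UU pq UFG; split.
- by apply: (cF U p) => //; apply: filterS UFG => k [].
- by apply: (cG U p) => //; apply: filterS UFG => k [].
Qed.

Lemma seq_closedU F G : seq_closed F -> seq_closed G -> seq_closed (F `|` G).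
Proof.
move=> cF cG U p q UU pq UFG.
(* An ultrafilter that contains a union contains one of its members. *)
have [UF|UnF] := in_ultra_setVsetC [set k | F (p k)] UU.
  by left; apply: (cF U p).
right; apply: (cG U p) => //.
by apply: filterS (filterI UFG UnF) => k /= [[]].
Qed.

Lemma seq_closed_cylinder (i : nat) (C : set V) :
  closed C -> seq_closed [set x | C (x i)].
Proof. by move=> cC U p q UU pq UC; exact: (closed_cvg _ cC UC _ (pq i)). Qed.

End seq_closed_theory.

(** * The algebra of regular sets *)

(** Approximation by a closed [F] inside and an open [G] outside, up to small [L]. Both are asked to
    be measurable because [L] is additive on measurable sets only. *)
Definition regular_set {R : realType} {d : nat}
    (L : set (Rinf R d) -> \bar R) (A : set (Rinf R d)) :=
  measurable A /\ forall e : R, (0 < e)%R -> exists F G : set (Rinf R d),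
    [/\ measurable F, measurable G, seq_closed (F : set (nat -> 'rV[R]_d)),
        seq_closed (~` G : set (nat -> 'rV[R]_d)) &
        [/\ F `<=` A, A `<=` G & L (G `\` F) < e%:E]].

Section regular_set_algebra.
Context {R : realType} {d : nat}.
Variable L : {content set (Rinf R d) -> \bar R}.

Lemma regular_set0 : regular_set L set0.
Proof.
split => // e e0; exists set0, set0; split => //.
- exact: seq_closed0.
- by rewrite setC0; exact: seq_closedT.
- by split => //; rewrite setD0 measure0 lte_fin.
Qed.

Lemma regular_setC (A : set (Rinf R d)) :
  regular_set L A -> regular_set L (~` A).
Proof.
move=> [mA rA]; split; first exact: measurableC.
move=> e /rA[F [G [mF mG cF cG [FA AG LGF]]]].
exists (~` G), (~` F); split => //; [exact: measurableC..|by rewrite setCK|].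
split; [exact: subsetC..|].
by rewrite setDE setCK setIC -setDE.
Qed.

Lemma regular_setU (A B : set (Rinf R d)) :
  regular_set L A -> regular_set L B -> regular_set L (A `|` B).
Proof.
move=> [mA rA] [mB rB]; split; first exact: measurableU.
move=> e e0; have e20 : (0 < e / 2)%R by rewrite divr_gt0.
have [F [G [mF mG cF cG [FA AG LGF]]]] := rA _ e20.
have [F' [G' [mF' mG' cF' cG' [FA' AG' LGF']]]] := rB _ e20.
exists (F `|` F'), (G `|` G'); split; [exact: measurableU..| | |].
- exact: seq_closedU.
- by rewrite setCU; exact: seq_closedI.
split; [exact: setUSS..|].
rewrite (splitr e) EFinD; apply: le_lt_trans (lteD LGF LGF').
apply: content_leU2; [|exact: measurableD..|].
  by apply: measurableD; exact: measurableU.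
by move=> x [[Gx|Gx] /not_orP[nF nF']]; [left|right].
Qed.

Lemma regular_setI (A B : set (Rinf R d)) :
  regular_set L A -> regular_set L B -> regular_set L (A `&` B).
Proof.
move=> rA rB; rewrite -(setCK A) -(setCK B) -setCU.
by apply: regular_setC; apply: regular_setU; exact: regular_setC.
Qed.

End regular_set_algebra.

(** * The restriction of [L] to its regular sets *)

Section regular_content.
Context {R : realType} {d : nat}.
Variable L : {content set (Rinf R d) -> \bar R}.

(** A copy of [Rinf] indexed by [L], so that the regular sets of this [L] can become its measurable
    sets. *)
Definition regular_type (_ : {content set (Rinf R d) -> \bar R}) := Rinf R d.

HB.instance Definition _ := Pointed.on (regular_type L).

HB.instance Definition _ := isAlgebraOfSets.Build default_measure_display
  (regular_type L) (regular_set0 L) (regular_setU (L := L))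
  (regular_setC (L := L)).

Definition regular_content (A : set (regular_type L)) : \bar R := L A.

Lemma regular_content_semi_additive :
  measure_function.semi_additive regular_content.
Proof.
move=> F n mF tF mU; rewrite /regular_content measure_semi_additive//.
- by move=> k; case: (mF k).
- by case: mU.
Qed.

HB.instance Definition _ := isContent.Build _ _ _ regular_content
  (measure_ge0 L) regular_content_semi_additive.

End regular_content.

Arguments regular_content {R d} L A.

(** * Countable additivity and Caratheodory extension *)

Section regular_extension.
Context {R : realType} {d : nat}.
Variable L : {content set (Rinf R d) -> \bar R}.
Hypothesis L_tight : forall (i : nat) (e : R), (0 < e)%R ->
  exists C : set 'rV[R]_d,
    [/\ compact C, measurable ([set x | ~ C (x i)] : set (Rinf R d)) &
        L [set x | ~ C (x i)] <= e%:E].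

(* Points outside longer and longer parts of the cover have an ultrafilter
   limit, which lies outside the whole cover. *)
Lemma seq_closed_finite_cover (F : set (nat -> 'rV[R]_d))
    (G : nat -> set (nat -> 'rV[R]_d)) (C : nat -> set 'rV[R]_d) :
  seq_closed F -> (forall n, seq_closed (~` G n)) ->
  (forall i, compact (C i)) -> F `<=` \bigcup_n G n ->
  exists N : nat,
    F `<=` \big[setU/set0]_(n < N) (G n `|` [set x | ~ C n (x n)]).
Proof.
move=> cF cG cC FG; apply: contrapT => /forallNP nN.
have /choice[p pP] : forall N, exists x, F x /\
    forall n, (n < N)%N -> ~ G n x /\ C n (x n).
  move=> N; have /existsNP[x /not_implyP[Fx]] := nN N.
  rewrite -(bigcup_mkord N (fun n => G n `|` [set x | ~ C n (x n)])) => nx; exists x; split => // n nN'.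
  split=> [Gx|]; first by apply: nx; exists n => //; left.
  by apply: contrapT => nCx; apply: nx; exists n => //; right.
have [U [UU ooU]] := ultraFilterLemma (F := \oo) _.
have Ugt n : U [set k | (n < k)%N] by apply: ooU; exists n.+1.
have /choice[q qP] : forall i, exists q, C i q /\ p k i @[k --> U] --> q.
  (* Coordinate [i] of [p k] lies in the compact set [C i] once [i < k], hence on a member of
     [U]. *)
  move=> i; have [|q Cq pq] := ultra_compact_cvg (u := p ^~ i) UU (cC i).
    by apply: filterS (Ugt i) => k /(pP k).2[].
  by exists q.
have pq i : p k i @[k --> U] --> q i by case: (qP i).
have Fq : F q by apply: (cF U p) => //; apply: filterS filterT => k _; case: (pP k).
have [n _ Gq] := FG _ Fq.
by apply: (cG n U p q) => //; apply: filterS (Ugt n) => k /(pP k).2[].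
Qed.

(** A closed [K] inside [A], open sets around the [F n] and a compact set for each coordinate reduce
    the countable cover to a finite one, where finite subadditivity suffices. *)
Lemma regular_content_sigma_subadditive :
  measurable_subset_sigma_subadditive (regular_content L).
Proof.
move=> A F rF rA AF; rewrite /regular_content.
apply/lee_addgt0Pr => e e0; have e20 : (0 < e / 2)%R by rewrite divr_gt0.
(* Half of [e] pays for [K]; the [n]-th share [e / 2 / 2 ^ n.+1] of the other half is split equally
   between [G n] and the points whose coordinate [n] is outside [C n]. *)
pose eps n : R := (e / 2 / (2 ^ n.+1)%:R / 2)%R.
have eps0 n : (0 < eps n)%R by rewrite /eps !divr_gt0// ltr0n expn_gt0.
have [K [H [mK mH cK cH [KA AH LHK]]]] := rA.2 _ e20.
have /choice[G GP] : forall n, exists G : set (Rinf R d), [/\ measurable G,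
    seq_closed (~` G : set (nat -> 'rV[R]_d)), F n `<=` G &
    L G <= L (F n) + (eps n)%:E].
  move=> n; have [K' [G [mK' mG cK' cG [KF FG LGK]]]] := (rF n).2 _ (eps0 n).
  exists G; split => //; apply: le_trans (leeD2l _ (ltW LGK)).
  apply: content_leU2 => //; [by case: (rF n)|exact: measurableD|].
  move=> x Gx; have [K'x|nK'x] := pselect (K' x); [left|by right].
  exact: KF.
have /choice[C CP] := fun n => L_tight n (eps0 n).
have [N KN] : exists N : nat,
    K `<=` \big[setU/set0]_(n < N) (G n `|` [set x | ~ C n (x n)]).
  apply: seq_closed_finite_cover => //.
  - by move=> n; case: (GP n).
  - by move=> n; case: (CP n).
  - move=> x /KA/AF[n _ Fx]; exists n => //.
    by case: (GP n) => _ _ + _; apply.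
have mA : measurable (A : set (Rinf R d)) by case: rA.
have mB n : measurable (G n `|` [set x | ~ C n (x n)] : set (Rinf R d)).
  by case: (GP n) => ? _ _ _; case: (CP n) => _ ? _; exact: measurableU.
have LAK : L A <= L K + (e / 2)%:E.
  apply: le_trans (leeD2l _ (ltW LHK)).
  apply: content_leU2 => //; first exact: measurableD.
  move=> x Ax; have [Kx|nKx] := pselect (K x); [by left|right].
  by split => //; exact: AH.
apply: (le_trans LAK); rewrite [leRHS](_ : _ =
  \sum_(0 <= n <oo) L (F n) + (e / 2)%:E + (e / 2)%:E); last first.
  by rewrite -addeA -EFinD -splitr.
rewrite leeD2r//.
apply: (@le_trans _ _ (\sum_(n < N) (L (F n) + (e / 2 / (2 ^ n.+1)%:R)%:E))).
  apply: le_trans (content_subadditive L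
    (F := fun n => G n `|` [set x | ~ C n (x n)]) _ mK KN) _ => //.
  apply: lee_sum => n _.
  case: (GP n) => mG _ _ LG; case: (CP n) => _ mC LC.
  apply: le_trans (content_leU2 L (mB n) mG mC (fun x => id)) _.
  rewrite (splitr (e / 2 / _)) EFinD addeA.
  by apply: leeD.
apply: (@le_trans _ _ (\sum_(0 <= n <oo) (L (F n) + (e / 2 / (2 ^ n.+1)%:R)%:E))).
  rewrite -(big_mkord xpredT (fun n => L (F n) + (e / 2 / (2 ^ n.+1)%:R)%:E)).
  apply: nneseries_lim_ge => n _ _; apply: adde_ge0 => //.
  by rewrite lee_fin !divr_ge0 ?(ltW e0)// ler0n.
by apply: epsilon_trick => //; exact: ltW.
Qed.

HB.instance Definition _ := Content_SigmaSubAdditive_isMeasure.Build _ _ _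
  (regular_content L) regular_content_sigma_subadditive.

(** Caratheodory's measure lives on the sigma-algebra generated by the regular sets. It contains
    that of [Rinf] because cylinders are regular, so pushing forward along the identity restricts
    it. *)
Lemma regular_extension : L setT = 1 ->
  (forall A, cylinders R d A -> regular_set L A) ->
  exists gam : probability (Rinf R d) R,
    forall A, regular_set L A -> gam A = L A.
Proof.
move=> LT cylr.
pose ext := measure_extension
  (regular_content L : {measure set (regular_type L) -> \bar R}).
have mid : measurable_fun [set: g_sigma_algebraType
    (@measurable default_measure_display (regular_type L))]
    (id : _ -> Rinf R d).
  move=> _ A mA; rewrite setTI; move: A mA; apply: smallest_sub.
    exact: smallest_sigma_algebra.
  by move=> A /cylr rA; exact: sub_sigma_algebra.
have extE (A : set (Rinf R d)) : regular_set L A -> ext A = L A.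
  by move=> rA; rewrite /ext /measure_extension measurable_mu_extE.
have extT : ext setT = 1.
  by rewrite extE// -setC0; apply: regular_setC; exact: regular_set0.
pose P : probability (g_sigma_algebraType
    (@measurable default_measure_display (regular_type L))) R :=
  HB.pack ext (Measure_isProbability.Build _ _ _ ext extT).
pose idm : {mfun g_sigma_algebraType
    (@measurable default_measure_display (regular_type L)) >-> Rinf R d} :=
  HB.pack (id : _ -> Rinf R d) (isMeasurableFun.Build _ _ _ _ _ mid).
by exists (distribution P idm) => A rA; exact: extE.
Qed.

End regular_extension.

(** * Inner approximation and tightness of laws on the space of row vectors *)

(** The differences of [A] and [F n] decrease to the empty set, and [P] is finite, so continuity
    from above applies. *)
Lemma probability_exhaust (dd : measure_display) (T : measurableType dd)
    (R : realType) (P : probability T R) (A : set T) (F : nat -> set T) :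
  measurable A -> (forall n, measurable (F n)) -> nondecreasing_seq F ->
  \bigcup_n F n = A -> forall e : R, (0 < e)%R ->
  exists n, P (A `\` F n) < e%:E.
Proof.
move=> mA mF ndF FA e e0.
have DF0 : \bigcap_n (A `\` F n) = set0.
  rewrite -subset0 => x capx; have [Ax _] := capx 0%N I.
  by move: Ax; rewrite -FA => -[n _ Fx]; have [_] := capx n I.
have : P (A `\` F n) @[n --> \oo] --> P (\bigcap_n (A `\` F n)).
  apply: nonincreasing_cvg_mu.
  - by rewrite (le_lt_trans (probability_le1 _ _)) ?ltry//; exact: measurableD.
  - by move=> n; exact: measurableD.
  - by rewrite DF0.
  - move=> m n mn; apply/subsetPset => x [Ax nFx]; split => // Fx.
    by apply: nFx; move/subsetPset : (ndF _ _ mn); apply.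
rewrite DF0 measure0 => cv.
have /cv[n _ nP] : nbhs (0 : \bar R) [set y | y < e%:E].
  by apply: open_nbhs_nbhs; split; [exact: open_ereal_lt_ereal|rewrite /= lte_fin].
by exists n; apply: nP => /=.
Qed.

Section inner_balls.
Context {R : realType} {V : pseudoMetricNormedZmodType R}.

(** The points at distance at least [1 / (n + 1)] from the complement of [O]. *)
Definition inner_balls (O : set V) (n : nat) : set V :=
  [set v | ball v n.+1%:R^-1 `<=` O].

Lemma inner_balls_closed (O : set V) n : closed (inner_balls O n).
Proof.
rewrite -[X in closed X]setCK; apply: open_closedC; rewrite openE => v /=.
move=> /existsNP[w /not_implyP[vw nOw]].
(* A point [w] outside [O] in the ball around [v] stays in the ball around every point near [v]. *)
have : nbhs v (ball w n.+1%:R^-1).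
  apply: open_nbhs_nbhs; split; first exact: ball_open.
  exact: ball_sym.
apply: filterS => v' wv' sub; apply: nOw; apply: sub.
exact: ball_sym.
Qed.

Lemma inner_balls_nondecreasing (O : set V) : nondecreasing_seq (inner_balls O).
Proof.
move=> m n mn; apply/subsetPset => v; apply: subset_trans.
by apply: le_ball; rewrite lef_pV2 ?posrE ?ltr0n// ler_nat.
Qed.

Lemma bigcup_inner_balls (O : set V) : open O -> \bigcup_n inner_balls O n = O.
Proof.
move=> oO; apply/seteqP; split => [v [n _]|v Ov].
  by apply; apply: ballxx; rewrite invr_gt0 ltr0n.
have : nbhs v O by apply: open_nbhs_nbhs.
move=> /nbhs_ballP[e /= e0 eO].
have [n _ nP] := near_infty_natSinv_lt (PosNum e0).
exists n => //; apply: subset_trans eO; apply: le_ball; apply: ltW.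
by apply: nP => /=.
Qed.

End inner_balls.

Section borel_Rd.
Context {R : realType} {d : nat}.

Lemma Rd_open_measurable (O : set 'rV[R]_d) :
  open O -> measurable (O : set (Rd R d)).
Proof. exact: sub_sigma_algebra. Qed.

Lemma Rd_closed_measurable (C : set 'rV[R]_d) :
  closed C -> measurable (C : set (Rd R d)).
Proof.
move=> cC; rewrite -(setCK C); apply: measurableC.
by apply: Rd_open_measurable; exact: closed_openC.
Qed.

Lemma measurable_coord (i : nat) :
  measurable_fun setT (fun x : Rinf R d => x i : Rd R d).
Proof.
apply: (@measurability _ _ (Rinf R d) (Rd R d) _ _ (@open 'rV[R]_d)) => //.
move=> _ [O oO <-]; apply: sub_sigma_algebra.
by exists i => //; exists O.
Qed.

Lemma measurable_cylinder (i : nat) (B : set (Rd R d)) :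
  measurable B -> measurable ([set x | B (x i)] : set (Rinf R d)).
Proof. by move=> mB; rewrite -[X in measurable X]setTI; exact: measurable_coord. Qed.

Lemma Rd_tight (mu : probability (Rd R d) R) (e : R) : (0 < e)%R ->
  exists C : set 'rV[R]_d, [/\ compact C, measurable (C : set (Rd R d)) &
    mu (~` C) < e%:E].
Proof.
(* Closed balls exhaust the space and are compact, the dimension being finite. *)
move=> e0; pose C (n : nat) : set 'rV[R]_d := [set v | (`|v| <= n%:R)%R].
have cC n : closed (C n).
  rewrite (_ : C n = (fun v => `|v|%R) @^-1` [set r : R | (r <= n%:R)%R]) //.
  by apply: closed_comp => [v _|]; [exact: norm_continuous|exact: closed_le].
have mC n : measurable (C n : set (Rd R d)) by exact: Rd_closed_measurable.
have [||n nP] := probability_exhaust mu measurableT mC _ _ e0.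
- move=> m n mn; apply/subsetPset => v /= /le_trans; apply.
  by rewrite ler_nat.
- rewrite -subTset => v _; exists (Num.bound `|v|%R) => //=.
  by apply: ltW; exact: archi_boundP.
exists (C n); split => //; last by rewrite -setTD.
apply: bounded_closed_compact => //.
exists n%:R; split; first exact: num_real.
by move=> M nM v /= /le_trans; apply; exact: ltW.
Qed.

Section marginal.
Variables (L : {content set (Rinf R d) -> \bar R}) (mu : probability (Rd R d) R).
Hypothesis L_marginal : forall (i : nat) (B : set (Rd R d)), measurable B ->
  L [set x | B (x i)] = mu B.

(** The cylinder is its own outer approximation. Inside, the error depends on one coordinate, so the
    countable additivity of [mu] makes it small. *)
Lemma regular_open_cylinder (i : nat) (O : set 'rV[R]_d) :
  open O -> regular_set L [set x | O (x i)].
Proof.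
move=> oO; have mO := Rd_open_measurable oO.
split; first exact: measurable_cylinder.
move=> e e0.
have mI n : measurable (inner_balls O n : set (Rd R d)).
  by apply: Rd_closed_measurable; exact: inner_balls_closed.
have [n nP] := probability_exhaust mu mO mI
  (@inner_balls_nondecreasing _ _ O) (bigcup_inner_balls oO) e0.
exists [set x | inner_balls O n (x i)], [set x | O (x i)]; split.
- exact: measurable_cylinder.
- exact: measurable_cylinder.
- by apply: seq_closed_cylinder; exact: inner_balls_closed.
- rewrite (_ : ~` _ = [set x | (~` O) (x i)])//.
  by apply: seq_closed_cylinder; exact: open_closedC.
- split => //.
    by move=> x /=; apply; apply: ballxx; rewrite invr_gt0 ltr0n.
  rewrite (_ : _ `\` _ = [set x | (O `\` inner_balls O n) (x i)])//.
  by rewrite L_marginal//; exact: measurableD.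
Qed.

Lemma marginal_extension :
  exists gam : probability (Rinf R d) R,
    forall A, regular_set L A -> gam A = L A.
Proof.
apply: regular_extension.
- move=> i e e0; have [C [cC mC muC]] := Rd_tight mu e0.
  exists C; split => //; first by apply: measurable_cylinder (measurableC mC).
  by rewrite (L_marginal i (measurableC mC)) ltW.
- have := L_marginal 0 measurableT; rewrite probability_setT.
  by rewrite (_ : [set x | _] = setT).
- move=> A [i _ [O oO <-]]; rewrite setTI; exact: regular_open_cylinder.
Qed.

End marginal.
End borel_Rd.

(** * Two-body marginals of exchangeable laws *)

Lemma perm_two_points (n : nat) (i j : 'I_n.+2) : i != j ->
  exists s : {perm 'I_n.+2}, s ord0 = i /\ s (lift ord0 ord0) = j.
Proof.
(* [b] is the image of the second index under the first transposition; the second transposition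
   moves [b] to [j] and fixes [i]. *)
move=> ij; pose b := tperm ord0 i (lift ord0 ord0).
have bi : b != i.
  by rewrite /b -[X in _ != X](tpermL ord0 i) (inj_eq perm_inj).
exists (tperm ord0 i * tperm b j)%g; rewrite !permM tpermL; split.
  by rewrite tpermD// eq_sym.
by rewrite -/b tpermL.
Qed.

Section two_body_law.
Context {R : realType} {d : nat}.

Definition coord_pair (i j : nat) (x : Rinf R d) : Rd R d * Rd R d := (x i, x j).

Lemma measurable_coord_pair (i j : nat) :
  measurable_fun setT (coord_pair i j).
Proof. by apply: measurable_fun_pair; exact: measurable_coord. Qed.

HB.instance Definition _ (i j : nat) := isMeasurableFun.Build _ _ _ _
  (coord_pair i j) (measurable_coord_pair i j).

(** Exchangeability is used on a block containing [i] and [j], for an event that reads only the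
    first two entries. *)
Lemma sym_inf_coord_pair (gam : probability (Rinf R d) R) (i j : nat)
    (A : set (Rd R d * Rd R d)) : sym_inf gam -> i <> j -> measurable A ->
  gam (coord_pair i j @^-1` A) = gam (coord_pair 0 1 @^-1` A).
Proof.
(* A block of length [n.+2] contains [i] and [j] and always has the indices [ord0] and
   [lift ord0 ord0]. *)
move=> sgam ij mA; pose n := maxn i j.
have ni : (i < n.+2)%N by rewrite ltnS ltnW// ltnS leq_maxl.
have nj : (j < n.+2)%N by rewrite ltnS ltnW// ltnS leq_maxr.
have [|s [s0 s1]] := @perm_two_points n (Ordinal ni) (Ordinal nj).
  by apply/eqP => -[].
pose B : set (n.+2.-tuple (Rd R d)) :=
  [set t | A (tnth t ord0, tnth t (lift ord0 ord0))].
have mB : measurable B.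
  rewrite -[X in measurable X]setTI.
  have : measurable_fun setT (fun t : n.+2.-tuple (Rd R d) =>
      (tnth t ord0, tnth t (lift ord0 ord0))).
    by apply: measurable_fun_pair; exact: measurable_tnth.
  by apply.
have := sgam n.+2 (@nat_of_ord _) (@ord_inj _) s B mB.
rewrite (_ : coords _ @^-1` B = coord_pair 0 1 @^-1` A); last first.
  by apply/seteqP; split => x; rewrite /B /coords /= !tnth_mktuple.
move=> ->; congr (gam _).
by apply/seteqP; split => x; rewrite /B /coords /= !tnth_mktuple /= s0 s1.
Qed.

Definition pair_law (gam : probability (Rinf R d) R) :
  probability (Rd R d * Rd R d)%type R := distribution gam (coord_pair 0 1).

Lemma two_body_pair_law (gam : probability (Rinf R d) R) :
  sym_inf gam -> two_body gam (pair_law gam).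
Proof. by move=> sgam i j ij A mA; exact: sym_inf_coord_pair. Qed.

(** Swapping the factors turns the pair of coordinates 0, 1 into 1, 0, again two distinct
    coordinates. *)
Lemma sym2_pair_law (gam : probability (Rinf R d) R) :
  sym_inf gam -> sym2 (pair_law gam).
Proof. by move=> sgam A mA; exact: (sym_inf_coord_pair (i := 1%N) (j := 0%N)). Qed.

Lemma one_body2_pair_law (gam : probability (Rinf R d) R) mu :
  one_body gam mu -> one_body2 (pair_law gam) mu.
Proof. by move=> gmu A mA; exact: gmu. Qed.

Lemma two_body_one_body (gam : probability (Rinf R d) R) nu mu :
  two_body gam nu -> one_body2 nu mu -> one_body gam mu.
Proof.
move=> gnu numu A mA; rewrite -numu//.
rewrite -(gnu 0%N 1%N)//.
by rewrite -[X in measurable X]setTI; exact: measurable_fst.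
Qed.

(** * Cost of an exchangeable law *)

Section cost.
Variable c : 'rV[R]_d * 'rV[R]_d -> \bar R.
Hypotheses (c_ge0 : forall p, 0 <= c p) (c_meas : measurable_fun setT (cost2 c)).

Lemma measurable_cost (i j : nat) :
  measurable_fun setT (fun x : Rinf R d => c (x i, x j)).
Proof.
exact: (measurableT_comp (f := cost2 c) c_meas (measurable_coord_pair i j)).
Qed.

Lemma two_body_integral (gam : probability (Rinf R d) R) nu (i j : nat) :
  two_body gam nu -> i <> j ->
  \int[gam]_x c (x i, x j) = \int[nu]_p cost2 c p.
Proof.
move=> gnu ij.
rewrite -(ge0_integral_distribution (coord_pair i j) (f := cost2 c))//.
by apply: eq_measure_integral => A mA _; exact: (gnu i j ij A mA).
Qed.

(** Counting by the larger index, [j] has [j] smaller partners, and these numbers add up to a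
    triangular number. *)
Lemma sum_ltn_ord (N : nat) : (\sum_(i < N) \sum_(j < N | i < j) 1 = 'C(N, 2))%N.
Proof.
rewrite (exchange_big_dep xpredT)//= -triangular_sum.
rewrite big_mkord; apply: eq_bigr => j _.
rewrite (big_ord_narrow (ltnW (ltn_ord j))).
by rewrite sum1_card card_ord.
Qed.

(* Every pair of coordinates has the same law, so the sequence whose limit is
   [C_inf] is constant from [N = 2] on. *)
Lemma C_inf_two_body (gam : probability (Rinf R d) R) nu :
  two_body gam nu -> C_inf c gam = \int[nu]_p cost2 c p.
Proof.
move=> gnu; set I := \int[nu]_p _.
apply/cvg_lim => //; apply: cvg_near_cst; exists 2%N => // N /= N2.
rewrite [X in _ * X](_ : _ = \sum_(i < N) \sum_(j < N | (i < j)%N) I); last first.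
  (* Zero terms replace the condition [i < j], so that the integral can be exchanged with
     unconditional sums. *)
  rewrite (eq_integral (fun x : Rinf R d => \sum_(i < N) \sum_(j < N)
      if (i < j)%N then c (x i, x j) else 0)); last first.
    by move=> x _; apply: eq_bigr => i _; exact: big_mkcond.
  rewrite ge0_integral_sum//=; last 2 first.
  - move=> i; apply: emeasurable_sum => j.
    by case: (i < j)%N => //; exact: measurable_cost.
  - by move=> i x _; apply: sume_ge0 => j _; case: ifPn.
  apply: eq_bigr => i _; rewrite ge0_integral_sum//=; last 2 first.
  - by move=> j; case: (i < j)%N => //; exact: measurable_cost.
  - by move=> j x _; case: ifPn.
  rewrite [RHS]big_mkcond/=; apply: eq_bigr => j _.
  case: ifPn => ij; last by rewrite integral0.
  apply: two_body_integral => // ijE; by rewrite ijE ltnn in ij.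
have I0 : 0 <= I by exact: integral_ge0.
have -> : \sum_(i < N) \sum_(j < N | (i < j)%N) I = ('C(N, 2))%:R%:E * I.
  rewrite -sum_ltn_ord natr_sum -sumEFin ge0_sume_distrl//.
  apply: eq_bigr => i _; rewrite natr_sum -sumEFin ge0_sume_distrl//.
  by apply: eq_bigr => j _; rewrite mul1e.
rewrite muleA -EFinM mulVf ?mul1e//.
by rewrite pnatr_eq0 -lt0n bin_gt0.
Qed.

End cost.
End two_body_law.

(** * Open sets of pairs as countable unions of boxes *)

Section open_boxes.
Context {R : realType} {d : nat}.

Lemma rV_rat_dense (v : 'rV[R]_d) (e : R) : (0 < e)%R ->
  exists q : 'rV[rat]_d, ball v e (map_mx ratr q).
Proof.
move=> e0.
have /choice[q qP] : forall j : 'I_d, exists q : rat,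
    (`|v ord0 j - ratr q| < e)%R.
  move=> j; have [|q] := @rat_in_itvoo R (v ord0 j - e) (v ord0 j + e).
    by rewrite ltrD2l gtrN.
  by rewrite in_itv /= => qv; exists q; rewrite distrC ltr_distl.
exists (\row_j q j); split => // i j.
by rewrite !mxE ord1; exact: qP.
Qed.

(** There are countably many boxes with rational centres and radius [1 / (n + 1)]; those inside [O]
    cover it. *)
Lemma open_bigcup_boxes (O : set ('rV[R]_d * 'rV[R]_d)) : open O ->
  exists A B : nat -> set 'rV[R]_d,
    [/\ forall n, open (A n), forall n, open (B n) &
        O = \bigcup_n (A n `*` B n)].
Proof.
move=> oO; pose I := ('rV[rat]_d * 'rV[rat]_d * nat)%type.
pose b (q : 'rV[rat]_d) (n : nat) : set 'rV[R]_d :=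
  ball (map_mx ratr q : 'rV[R]_d) n.+1%:R^-1.
pose good (i : I) := b i.1.1 i.2 `*` b i.1.2 i.2 `<=` O.
(* [unpickle] enumerates the boxes; a code of no box, or of a box not inside [O], yields the empty
   set. *)
pose box (pr : I -> 'rV[rat]_d) (n : nat) : set 'rV[R]_d :=
  if unpickle n is Some i then if `[< good i >] then b (pr i) i.2 else set0
  else set0.
have obox pr n : open (box pr n).
  rewrite /box; case: unpickle => [i|]; last exact: open0.
  by case: ifPn => _; [exact: ball_open|exact: open0].
exists (box (fun i => i.1.1)), (box (fun i => i.1.2)); split => //.
apply/seteqP; split => [p Op|p [n _ []]]; last first.
  rewrite /box; case: unpickle => [i|//].
  by case: ifPn => // /asboolP gi pb1 pb2; apply: gi.
have : nbhs p O by apply: open_nbhs_nbhs.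
(* Half of [e] goes to the distance from [p] to the rational centre, half to the radius of the
   box. *)
move=> /nbhs_ballP[e /= e0 eO]; have e20 : (0 < e / 2)%R by rewrite divr_gt0.
have [n _ nP] := near_infty_natSinv_lt (PosNum e20).
have ne : (n.+1%:R^-1 < e / 2)%R by apply: nP => /=.
have n0 : (0 < n.+1%:R^-1 :> R)%R by rewrite invr_gt0.
have [q1 q1P] := rV_rat_dense p.1 n0.
have [q2 q2P] := rV_rat_dense p.2 n0.
have gi : good (q1, q2, n).
  move=> x /= [x1 x2]; apply: eO.
  have px1 : ball p.1 e x.1 := ball_split (le_ball (ltW ne) q1P)
    (le_ball (ltW ne) x1).
  have px2 : ball p.2 e x.2 := ball_split (le_ball (ltW ne) q2P)
    (le_ball (ltW ne) x2).
  by split.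
exists (pickle (q1, q2, n)); first by [].
rewrite /box pickleK /=.
by case: ifPn => [_|/asboolP//]; split; exact: ball_sym.
Qed.

End open_boxes.

(** * Layer-cake sums *)

Section superlevel_sums.
Context {R : realType}.

(** Times [t], this is a staircase below [y], within [t] of [y] capped at [K * t]. The inequality is
    strict so that the superlevel sets of a lower semicontinuous cost are open. *)
Definition level_count (t : R) (K : nat) (y : \bar R) : nat :=
  (\sum_(j < K) ((j.+1%:R * t)%R%:E < y)%E)%N.

Lemma level_countP (t : R) (K : nat) (y : \bar R) : (0 < t)%R -> 0 <= y ->
  level_count t K y = K /\ (K%:R * t)%:E <= y \/
  [/\ (level_count t K y <= K)%N, ((level_count t K y)%:R * t)%:E <= y &
      y <= ((level_count t K y).+1%:R * t)%:E].
Proof.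
move=> t0 y0; rewrite /level_count; elim: K => [|K IH].
  by left; rewrite big_ord0 mul0r.
rewrite big_ord_recr /=; set k := (\sum_(j < K) _)%N in IH *.
have [Ky|yK] := ltP _ y.
- left; case: IH => [[-> _]|[kK _ yk]]; first by rewrite addn1 (ltW Ky).
  (* Here [y] would be at most [k.+1 * t] with [k <= K], contrary to [Ky]. *)
  have := lt_le_trans Ky yk; rewrite lte_fin ltr_pM2r// ltr_nat ltnS.
  by rewrite ltnNge kK.
- by right; rewrite addn0; case: IH => [[-> ?]|[kK ? ?]]; split => //; exact: ltnW.
Qed.

Lemma level_count_le (t : R) (K : nat) (y : \bar R) : (0 < t)%R -> 0 <= y ->
  ((level_count t K y)%:R * t)%:E <= y.
Proof. by move=> t0 y0; case: (level_countP K t0 y0) => [[->]|[]]. Qed.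

Lemma level_count_ge (t : R) (K : nat) (y : \bar R) : (0 < t)%R -> 0 <= y ->
  mine (K%:R * t)%:E y <= ((level_count t K y)%:R * t)%:E + t%:E.
Proof.
move=> t0 y0; rewrite ge_min; case: (level_countP K t0 y0) => [[-> _]|[_ _ yk]].
  by rewrite -EFinD lee_fin lerDl ltW.
by rewrite -natr1 mulrDl mul1r EFinD in yk; rewrite yk orbT.
Qed.

Context {dd : measure_display} {T : measurableType dd}.
Variables (h : T -> \bar R).
Hypotheses (h_ge0 : forall x, 0 <= h x) (h_meas : measurable_fun setT h).

Definition superlevel (a : \bar R) : set T := [set x | a < h x].

(** A lower Riemann sum of the layer-cake formula. [P] is any set function, so the sum also applies
    to the finitely additive [L], and being finite it passes to ultrafilter limits. *)
Definition superlevel_sum (P : set T -> \bar R) (t : R) (K : nat) : \bar R :=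
  \sum_(j < K) t%:E * P (superlevel (j.+1%:R * t)%:E).

Lemma measurable_superlevel (a : \bar R) : measurable (superlevel a).
Proof. by rewrite -[X in measurable X]setTI; exact: emeasurable_fun_o_infty. Qed.

Lemma level_count_indic (t : R) (K : nat) (x : T) :
  ((level_count t K (h x))%:R * t)%:E =
  \sum_(j < K) t%:E * (\1_(superlevel (j.+1%:R * t)%:E) x)%:E.
Proof.
rewrite /level_count natr_sum mulr_suml -sumEFin; apply: eq_bigr => j _.
rewrite mulrC EFinM indicE; congr (_ * (nat_of_bool _)%:R%:E).
by apply/idP/idP; rewrite inE.
Qed.

Lemma measurable_level_count (t : R) (K : nat) :
  measurable_fun setT (fun x => ((level_count t K (h x))%:R * t)%:E).
Proof.
rewrite (_ : (fun x : T => _) = (fun x : T => \sum_(j < K) t%:E *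
    (\1_(superlevel (j.+1%:R * t)%:E) x)%:E)).
  apply: emeasurable_sum => j; apply: measurable_funeM.
  apply/measurable_EFinP; apply: measurable_indic.
  exact: measurable_superlevel.
by apply/funext => x; exact: level_count_indic.
Qed.

Lemma integral_level_count (P : probability T R) (t : R) (K : nat) :
  (0 < t)%R ->
  \int[P]_x ((level_count t K (h x))%:R * t)%:E = superlevel_sum P t K.
Proof.
move=> t0.
rewrite (eq_integral (fun x : T => \sum_(j < K) t%:E *
    (\1_(superlevel (j.+1%:R * t)%:E) x)%:E)); last first.
  by move=> x _; exact: level_count_indic.
have mI (j : nat) : measurable_fun setT (fun x =>
    (\1_(superlevel (j.+1%:R * t)%:E) x)%:E : \bar R).
  apply/measurable_EFinP; apply: measurable_indic.
  exact: measurable_superlevel.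
rewrite ge0_integral_sum//; last 2 first.
- by move=> j; apply: measurable_funeM; exact: mI.
- by move=> j x _; rewrite mule_ge0// ?lee_fin ?ltW.
apply: eq_bigr => j _; rewrite ge0_integralZl_EFin ?(ltW t0)//.
by rewrite integral_indic ?setIT//; exact: measurable_superlevel.
Qed.

Lemma superlevel_sum_le (P : probability T R) (t : R) (K : nat) : (0 < t)%R ->
  superlevel_sum P t K <= \int[P]_x h x.
Proof.
move=> t0; rewrite -integral_level_count//; apply: ge0_le_integral => //.
- by move=> x _; rewrite lee_fin mulr_ge0// ltW.
- exact: measurable_level_count.
- by move=> x _; exact: level_count_le.
Qed.

(** The truncation of [h] at [n] exceeds a fine enough staircase by at most the step [e], so its
    integral is at most [M + e]; then [e] tends to 0 and monotone convergence removes the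
    truncation. *)
Lemma integral_le_superlevel_sum (P : probability T R) (M : \bar R) :
  (forall (t : R) (K : nat), (0 < t)%R -> superlevel_sum P t K <= M) ->
  \int[P]_x h x <= M.
Proof.
move=> PM; pose g (n : nat) (x : T) := mine n%:R%:E (h x).
have g0 n x : 0 <= g n x by rewrite /g le_min h_ge0 lee_fin ler0n.
have mg n : measurable_fun setT (g n) by apply: measurable_mine.
have ndg x : nondecreasing_seq (g ^~ x).
  by move=> m n mn; rewrite /g le_min2 ?lexx// lee_fin ler_nat.
have gh x : limn (g ^~ x) = h x.
  apply/cvg_lim => //; rewrite /g; case: (h x) (h_ge0 x) => [r| |] // _.
    apply: cvg_near_cst; exists (Num.bound `|r|%R) => // n /= rn.
    apply/min_idPr; rewrite lee_fin (le_trans (ler_norm r))// ltW//.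
    by rewrite (lt_le_trans (archi_boundP (normr_ge0 r)))// ler_nat.
  under eq_fun do rewrite miney.
  by apply/cvgenyP; exact: cvg_id.
have gM n : \int[P]_x g n x <= M.
  apply/lee_addgt0Pr => e e0.
  (* [K] steps of height [e] reach [n]. *)
  pose K := (Num.bound (n%:R / e)).
  have nK : (n%:R <= K%:R * e)%R.
    by rewrite -ler_pdivrMr// ltW// archi_boundP// divr_ge0// ltW.
  apply: le_trans (leeD2r _ (PM e K e0)).
  rewrite -integral_level_count//.
  have eI : e%:E = \int[P]_x (cst e%:E x).
    by rewrite integral_cst//= probability_setT mule1.
  rewrite [X in _ + X]eI.
  rewrite -ge0_integralD//; last 3 first.
  - by move=> x _; rewrite lee_fin mulr_ge0// ltW.
  - exact: measurable_level_count.
  - by move=> x _; rewrite lee_fin ltW.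
  apply: ge0_le_integral => //.
  - by apply: emeasurable_funD => //; exact: measurable_level_count.
  - move=> x _; apply: le_trans (level_count_ge K e0 (h_ge0 x)).
    by rewrite /g le_min2 ?lexx// lee_fin.
rewrite (_ : \int[P]_x h x = \int[P]_x limn (g ^~ x)).
  rewrite monotone_convergence//; apply: lime_le.
    apply: ereal_nondecreasing_is_cvgn => m n mn.
    by apply: ge0_le_integral => // x _; exact: ndg.
  by apply: nearW.
by apply: eq_integral => x _; rewrite gh.
Qed.

End superlevel_sums.

(** * Open rectangles determine the laws of tuples *)

Section open_rectangles.
Context {R : realType} {d : nat}.

Definition open_rectangle (n : nat) : set (set (n.-tuple (Rd R d))) :=
  [set B | exists2 O : 'I_n -> set 'rV[R]_d, (forall i, open (O i)) &
    B = [set t | forall i, O i (tnth t i)]].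

Lemma measurable_open_rectangle (n : nat) (B : set (n.-tuple (Rd R d))) :
  open_rectangle B -> measurable B.
Proof.
move=> [O oO ->].
rewrite (_ : mkset _ = \big[setI/setT]_(i < n) [set t | O i (tnth t i)]).
  apply: bigsetI_measurable => i _; rewrite -[X in measurable X]setTI.
  by apply: measurable_tnth => //; exact: Rd_open_measurable.
by apply/seteqP; split => t /=; rewrite -bigcap_seq/= => tO i;
  [move=> _; exact: tO|apply: tO; rewrite /= mem_index_enum].
Qed.

Lemma measurable_tupleE (n : nat) :
  @measurable _ (n.-tuple (Rd R d)) = <<s @open_rectangle n >>.
Proof.
apply/seteqP; split => [B mB|]; last first.
  apply: smallest_sub; first exact: sigma_algebra_measurable.
  exact: measurable_open_rectangle.
have mid : measurable_fun setT (fun t : g_sigma_algebraType (@open_rectangle n) =>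
    t : n.-tuple (Rd R d)).
  apply/measurable_fun_tnthP => i.
  apply: (@measurability _ _ _ (Rd R d) _ _ (@open 'rV[R]_d)) => //.
  move=> _ [O oO <-]; apply: sub_sigma_algebra.
  (* A condition on coordinate [i] alone is a rectangle whose other sides are [setT]. *)
  exists (fun j => if j == i then O else setT).
    by move=> j; case: ifPn => // _; exact: openT.
  apply/seteqP; split => [t [_ Ot] j|t tO] /=; first by case: eqP => // ->.
  by split => //; have := tO i; rewrite eqxx.
by rewrite -[B]setTI; exact: mid.
Qed.

(** Open rectangles are stable under intersection and generate the sigma-algebra. This reduces
    exchangeability to sets whose preimages under [coords] turn out regular. *)
Lemma eq_measure_open_rectangle (n : nat)
    (P Q : probability (n.-tuple (Rd R d)) R) :
  (forall B, open_rectangle B -> P B = Q B) ->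
  forall B, measurable B -> P B = Q B.
Proof.
move=> PQ B mB.
have rT : @open_rectangle n setT.
  by exists (fun=> setT) => [i|]; [exact: openT|apply/seteqP].
apply: (measure_unique (@open_rectangle n) (fun=> setT)) => //.
- exact: measurable_tupleE.
- move=> _ _ [O oO ->] [O' oO' ->]; exists (fun i => O i `&` O' i).
    by move=> i; exact: openI.
  by apply/seteqP; split => [t [tO tO'] i|t tO]; [split|split=> i; case: (tO i)].
- by rewrite bigcup_const.
- by move=> k /=; rewrite probability_setT ltry.
Qed.

Lemma measurable_coords (n : nat) (f : 'I_n -> nat) :
  measurable_fun setT (@coords R d n f).
Proof.
apply/measurable_fun_tnthP => i.
rewrite (_ : _ \o _ = (fun x : Rinf R d => x (f i) : Rd R d)).
  exact: measurable_coord.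
by apply/funext => x; rewrite /coords /= tnth_mktuple.
Qed.

HB.instance Definition _ (n : nat) (f : 'I_n -> nat) :=
  isMeasurableFun.Build _ _ _ _ (@coords R d n f) (measurable_coords f).

End open_rectangles.

(** * Limits of exchangeable laws with fixed marginal *)

Section exchangeable_limit.
Context {R : realType} {d : nat}.
Variables (mu : probability (Rd R d) R) (gs : nat -> probability (Rinf R d) R).
Hypotheses (gs_sym : forall k, sym_inf (gs k))
           (gs_mu : forall k, one_body (gs k) mu).
Variable U : set_system nat.
Hypothesis UU : UltraFilter U.

Lemma sym_inf_marginal (gam : probability (Rinf R d) R) (i : nat)
    (B : set (Rd R d)) : sym_inf gam -> one_body gam mu -> measurable B ->
  gam [set x | B (x i)] = mu B.
Proof.
move=> sgam gmu mB; rewrite -(gmu _ mB).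
have mB1 : measurable [set p : Rd R d * Rd R d | B p.1].
  by rewrite -[X in measurable X]setTI; exact: measurable_fst.
by rewrite -(sym_inf_coord_pair sgam (@n_Sn i) mB1).
Qed.

(** On open sets only an inequality is obtained: [gam] reaches a countable union through its finite,
    regular parts, whereas for [L] only monotonicity is available. *)
Lemma exchangeable_limit :
  exists (L : {content set (Rinf R d) -> \bar R})
         (gam : probability (Rinf R d) R),
    [/\ forall A, measurable A -> gs k A @[k --> U] --> L A,
        sym_inf gam, one_body gam mu &
        forall O : set ('rV[R]_d * 'rV[R]_d), open O ->
          gam (coord_pair 0 1 @^-1` O) <= L (coord_pair 0 1 @^-1` O)].
Proof.
have [L gsL] := ultralimit_content gs UU.
have L_mu i (B : set (Rd R d)) : measurable B -> L [set x | B (x i)] = mu B.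
  move=> mB; have := gsL _ (measurable_cylinder i mB).
  under eq_fun do rewrite sym_inf_marginal//.
  by move=> /(cvg_unique _); apply => //; exact: cvg_cst.
have [gam gamL] := marginal_extension L_mu.
have rO := regular_open_cylinder L_mu.
exists L, gam; split => //.
- move=> n f finj s B mB.
  apply: (eq_measure_open_rectangle (P := distribution gam (coords f))
    (Q := distribution gam (coords (f \o s)))) mB => {}B rB.
  (* The preimage of an open rectangle is a finite intersection of open cylinders. *)
  have reg (g : 'I_n -> nat) : regular_set L (coords g @^-1` B).
    case: rB => O oO ->.
    rewrite (_ : _ @^-1` _ =
        \big[setI/setT]_(i < n) [set x : Rinf R d | O i (x (g i))]).
      elim/big_ind : _ => //.
      + by rewrite -setC0; apply: regular_setC; exact: regular_set0.
      + by move=> A A'; exact: regular_setI.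
      + by move=> i _; exact: rO.
    apply/seteqP; split => x /=; rewrite -bigcap_seq/= => xO i.
      by move=> _; have := xO i; rewrite /coords tnth_mktuple.
    by rewrite /coords tnth_mktuple; apply: xO; rewrite /= mem_index_enum.
  suff : gam (coords f @^-1` B) = gam (coords (f \o s) @^-1` B) by [].
  (* On these regular sets [gam] equals [L], which inherits the symmetry of the [gs k] in the
     limit. *)
  rewrite !gamL//.
  have := gsL _ (reg f).1; under eq_fun do
    rewrite (gs_sym _ finj s (measurable_open_rectangle rB)).
  by move=> /(cvg_unique _); apply => //; exact: gsL (reg _).1.
- move=> B mB.
  pose X : {mfun Rinf R d >-> Rd R d} := HB.pack
    (fun x : Rinf R d => x 0%N : Rd R d)
    (isMeasurableFun.Build _ _ _ _ _ (@measurable_coord R d 0)).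
  suff /(_ _ mB) : forall C : set (Rd R d), measurable C ->
    distribution gam X C = mu C by [].
  move=> C mC; apply: (@measure_unique _ R (Rd R d) (@open 'rV[R]_d)
    (fun=> setT) _ _ _ _ (distribution gam X) mu) => //.
  + exact: openI.
  + by move=> _; exact: openT.
  + by rewrite bigcup_const.
  + move=> O oO; rewrite -[RHS](L_mu 0%N _ (Rd_open_measurable oO)).
    by rewrite -gamL//; exact: rO.
  + by move=> k /=; rewrite probability_setT ltry.
- move=> O /open_bigcup_boxes[A [B [oA oB ->]]].
  pose E n : set (Rinf R d) := [set x | A n (x 0%N)] `&` [set x | B n (x 1%N)].
  have rE n : regular_set L (E n) by apply: regular_setI; exact: rO.
  have rEN n : regular_set L (\big[setU/set0]_(i < n) E i).
    elim/big_ind : _ => //; first exact: regular_set0.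
    by move=> ? ?; exact: regular_setU.
  rewrite (_ : _ @^-1` _ = \bigcup_n (\big[setU/set0]_(i < n) E i)).
    have mE : measurable (\bigcup_n (\big[setU/set0]_(i < n) E i)).
      by apply: bigcupT_measurable => n; case: (rEN n).
    have cv : gam (\big[setU/set0]_(i < n) E i) @[n --> \oo] -->
        gam (\bigcup_n (\big[setU/set0]_(i < n) E i)).
      apply: nondecreasing_cvg_mu => //; first by move=> n; case: (rEN n).
      by move=> m n mn; apply/subsetPset; exact: subset_bigsetU.
    rewrite -(cvg_lim _ cv)//; apply: lime_le; first by apply/cvg_ex; eexists; exact: cv.
    apply: nearW => n; rewrite gamL//; apply: le_measure; rewrite ?inE//.
      by case: (rEN n).
    exact: bigcup_sup.
  apply/seteqP; split => [x [n _ [An Bn]]|x [n _]].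
    by exists n.+1 => //; rewrite big_ord_recr; right.
  by rewrite -bigcup_mkord => -[i _ [Ai Bi]]; exists i.
Qed.

End exchangeable_limit.

(** * Existence of a minimizer *)

Section minimizer.
Context {R : realType} {d : nat}.
Variable mu : probability (Rd R d) R.

Definition diagonal (v : Rd R d) : Rinf R d := fun=> v.

Lemma measurable_diagonal : measurable_fun setT diagonal.
Proof.
apply: (@measurability _ _ (Rd R d) (Rinf R d) _ _ (cylinders R d)) => //.
move=> _ [_ [i _ [O oO <-]] <-]; rewrite !setTI.
exact: (Rd_open_measurable oO).
Qed.

HB.instance Definition _ := isMeasurableFun.Build _ _ _ _ diagonal
  measurable_diagonal.

Lemma exchangeable_exists :
  exists gam : probability (Rinf R d) R, sym_inf gam /\ one_body gam mu.
Proof.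
(* A constant sequence reads the same at all indices, so both conditions are immediate. *)
by exists (distribution mu diagonal).
Qed.

Variable c : 'rV[R]_d * 'rV[R]_d -> \bar R.
Hypotheses (c_ge0 : forall p, 0 <= c p) (c_meas : measurable_fun setT (cost2 c))
  (c_lsc : lower_semicontinuous c).

Lemma exchangeable_minimizer :
  exists gopt : probability (Rinf R d) R,
    [/\ sym_inf gopt, one_body gopt mu &
      forall gam : probability (Rinf R d) R, sym_inf gam -> one_body gam mu ->
      \int[gopt]_x c (x 0%N, x 1%N) <= \int[gam]_x c (x 0%N, x 1%N)].
Proof.
pose I (gam : probability (Rinf R d) R) := \int[gam]_x c (x 0%N, x 1%N).
pose adm := [set gam : probability (Rinf R d) R | sym_inf gam /\ one_body gam mu].
pose m := ereal_inf (I @` adm).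
have mI gam : adm gam -> m <= I gam by move=> ?; apply: ereal_inf_lbound; exists gam.
have m0 : 0 <= m.
  by apply: le_ereal_inf_tmp => _ [gam _ <-]; apply: integral_ge0 => x _; exact: c_ge0.
(* If [m] is infinite, every competitor is optimal; if it is finite, a minimizing sequence
   exists. *)
have [moo|mfin] := eqVneq m +oo.
  have [gam [sgam gmu]] := exchangeable_exists.
  exists gam; split => // gam' sgam' gmu'.
  by apply: le_trans (mI gam' (conj sgam' gmu')); rewrite moo leey.
have {}mfin : m \is a fin_num by rewrite ge0_fin_numE// lt_neqAle mfin leey.
have /choice[gs gsP] : forall k : nat, exists gam, adm gam /\
    I gam < m + (k.+1%:R^-1)%:E.
  move=> k; have k0 : (0 < k.+1%:R^-1 :> R)%R by rewrite invr_gt0.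
  by have [_ [gam agam <-] lt] := lb_ereal_inf_adherent k0 mfin; exists gam.
have [U [UU ooU]] := ultraFilterLemma (F := \oo) _.
have [||L [gam [gsL sgam gmu gamL]]] := @exchangeable_limit _ _ mu gs _ _ U UU.
- by move=> k; case: (gsP k) => -[].
- by move=> k; case: (gsP k) => -[].
exists gam; split => // gam' sgam' gmu'.
apply: le_trans (mI gam' (conj sgam' gmu')).
apply/lee_addgt0Pr => e e0.
pose h (x : Rinf R d) := c (x 0%N, x 1%N).
have h_meas : measurable_fun setT h by exact: measurable_cost.
have h_ge0 x : 0 <= h x by exact: c_ge0.
(* Sums for [gam] are at most those for [L], as superlevel sets of [c] are open; the latter are
   limits of sums for [gs k], each bounded by [I (gs k) < m + 1 / (k + 1)]. *)
apply: (integral_le_superlevel_sum h_ge0 h_meas) => t K t0.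
have cv : superlevel_sum h (gs k) t K @[k --> U] --> superlevel_sum h L t K.
  apply: cvg_nnesum => j _.
    by apply: nearW => k; rewrite mule_ge0// lee_fin ltW.
  by apply: cvgeZl => //; apply: gsL; exact: measurable_superlevel.
apply: (@le_trans _ _ (superlevel_sum h L t K)).
  apply: lee_sum => j _; apply: lee_wpmul2l; first by rewrite lee_fin ltW.
  apply: (gamL [set p | (j.+1%:R * t)%:E < c p]).
  exact: (lower_semicontinuousP c).1.
rewrite -(cvg_lim _ cv)//; apply: lime_le; first by apply/cvg_ex; eexists; exact: cv.
have [n _ nP] := near_infty_natSinv_lt (PosNum e0).
apply: ooU; exists n => // k nk /=.
apply: le_trans (superlevel_sum_le h_ge0 h_meas _ _ t0) _.
apply: (le_trans (ltW (gsP k).2)); rewrite leeD2l// lee_fin ltW//.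
exact: nP.
Qed.

End minimizer.

Unset Implicit Arguments.

Theorem theorem2p7 (R : realType) (d : nat)
  (c : 'rV[R]_d * 'rV[R]_d -> \bar R)
  (c_ge0 : forall p, 0 <= c p)
  (c_meas : measurable_fun setT (cost2 c))
  (c_sym : forall x y, c (x, y) = c (y, x))
  (c_lsc : lower_semicontinuous c)
  (mu : probability (Rd R d) R) :
  (exists gopt : probability (Rinf R d) R,
      sym_inf gopt /\ one_body gopt mu /\ C_inf c gopt = F_OT c mu) /\
  (exists mu2opt : probability (Rd R d * Rd R d)%type R,
      sym2 mu2opt /\ one_body2 mu2opt mu /\ inf_representable mu2opt /\
      \int[mu2opt]_(p in [set: (Rd R d * Rd R d)%type]) cost2 c p =
      ereal_inf [set \int[nu]_(p in [set: (Rd R d * Rd R d)%type]) cost2 c p | nu in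
                  [set nu : probability (Rd R d * Rd R d)%type R |
                    sym2 nu /\ one_body2 nu mu /\ inf_representable nu]]).
Proof.
have [gopt [sopt omu opt]] := exchangeable_minimizer mu c_ge0 c_meas c_lsc.
(* Both objectives equal the same integral over one pair of coordinates, so the optimality of [gopt]
   settles both problems. *)
have CE gam nu : two_body gam nu ->
    C_inf c gam = \int[gam]_x c (x 0%N, x 1%N) /\
    \int[nu]_p cost2 c p = \int[gam]_x c (x 0%N, x 1%N).
  move=> gnu; rewrite (C_inf_two_body c_ge0 c_meas gnu).
  by rewrite -(two_body_integral c_ge0 c_meas (i := 0) (j := 1) gnu).
have [CoptE IoptE] := CE _ _ (two_body_pair_law sopt).
split.
- exists gopt; split => //; split => //; apply/eqP; rewrite eq_le; apply/andP; split.
    apply: le_ereal_inf_tmp => _ [gam [sgam gmu] <-].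
    by rewrite CoptE (CE _ _ (two_body_pair_law sgam)).1; exact: opt.
  by apply: ereal_inf_lbound; exists gopt.
- have adm : sym2 (pair_law gopt) /\ one_body2 (pair_law gopt) mu /\
      inf_representable (pair_law gopt).
    split; first exact: sym2_pair_law.
    split; first exact: one_body2_pair_law.
    by exists gopt; split => //; exact: two_body_pair_law.
  exists (pair_law gopt); case: (adm) => ? [? ?]; do 3 split => //.
  apply/eqP; rewrite eq_le; apply/andP; split; last first.
    by apply: ereal_inf_lbound; exists (pair_law gopt).
  (* A representable competitor [nu] is the pair law of some [gam], whose one-body marginal is then
     [mu]. *)
  apply: le_ereal_inf_tmp => _ [nu [_ [numu [gam [sgam gnu]]]] <-].
  rewrite IoptE (CE _ _ gnu).2; apply: opt => //.
  exact: two_body_one_body gnu numu.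
Qed.
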